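(* Let $t$ denote the transpose map on $\mathcal{L}(\mathcal{H}_n)$. Then $\mathcal{M}_{\{t\}} = \mathcal{CP}\circ t$, where $\mathcal{CP}\circ t:=\{\Phi\circ t:\Phi\in\mathcal{CP}\}$.
   Context: $\mathcal{H}_n$ is an $n$-dimensional complex Hilbert space with a fixed orthonormal basis, $\mathcal{L}(\mathcal{H}_n)$ is the space of linear operators on it, and the transpose is taken with respect to this basis. A linear map $\Phi:\mathcal{L}(\mathcal{H}_n)\to\mathcal{L}(\mathcal{H}_n)$ is positive if $\Phi(X)\ge 0$ whenever $X\ge 0$ (positive semidefinite), and completely positive if $id_k\otimes\Phi$ is positive for every $k\in\mathbb{N}$, where $id_k$ is the identity map on $\mathcal{L}(\mathcal{H}_k)$. $\mathcal{P}_1$ and $\mathcal{CP}$ denote the sets of positive and completely positive maps on $\mathcal{L}(\mathcal{H}_n)$. For $\mathcal{Q}\subset\mathcal{P}_1$, the convex mapping cone generated by $\mathcal{Q}$ is $\mathcal{M}_{\mathcal{Q}}:=\{\sum_i\Phi_i\circ\Omega_i\circ\Psi_i:\Omega_i\in\mathcal{Q},\ \Phi_i,\Psi_i\in\mathcal{CP}\ \forall i\}$ (finite sums). *)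

(* Defs.v *)
From HB Require Import structures.
From mathcomp Require Import all_boot all_order all_algebra.
From mathcomp Require Import classical_sets reals.
From mathcomp Require Import complex mxtens.

Set Implicit Arguments.
Unset Strict Implicit.
Unset Printing Implicit Defensive.

Import Order.TTheory GRing.Theory Num.Theory.
Local Open Scope classical_set_scope.
Local Open Scope ring_scope.

(* Operators on the n-dimensional space with its fixed orthonormal basis are
   square matrices over [R[i]], and linear maps between operators are elements
   of ['End('M[R[i]]_n)], on which equality is extensional. *)

(* [<=] on [R[i]] is the partial order for which [0 <= z] says that [z] is real
   and nonnegative, so [psdmx X] forces [X] to be Hermitian. *)
Definition psdmx (R : realType) (n : nat) (X : 'M[R[i]]_n) : Prop :=
  forall v : 'cV[R[i]]_n, 0 <= (v ^t* *m X *m v)%sesqui 0 0.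

Definition positive_maps (R : realType) (n : nat) : set 'End('M[R[i]]_n) :=
  [set Phi | forall X : 'M[R[i]]_n, psdmx X -> psdmx (Phi X)].
Arguments positive_maps : clear implicits.

Section TensorProduct.
Variables (R : realType) (k n : nat).
Implicit Types (f : 'End('M[R[i]]_k)) (g : 'End('M[R[i]]_n)).

Definition tens_fun f g (X : 'M[R[i]]_(k * n)) : 'M[R[i]]_(k * n) :=
  \sum_(a < k) \sum_(b < k) \sum_(c < n) \sum_(d < n)
    X (mxtens_index (a, c)) (mxtens_index (b, d)) *:
      (f (delta_mx a b) *t g (delta_mx c d)).

Fact tens_fun_is_linear f g : linear (tens_fun f g).
Proof.
move=> z X Y; rewrite /tens_fun scaler_sumr -big_split; apply: eq_bigr => a _.
rewrite scaler_sumr -big_split; apply: eq_bigr => b _.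
rewrite scaler_sumr -big_split; apply: eq_bigr => c _.
rewrite scaler_sumr -big_split; apply: eq_bigr => d _ /=.
by rewrite !mxE scalerDl scalerA.
Qed.

HB.instance Definition _ f g :=
  GRing.isLinear.Build R[i] 'M[R[i]]_(k * n) 'M[R[i]]_(k * n) _
    (tens_fun f g) (tens_fun_is_linear f g).

(* The tensor product of [f] and [g]: operators on the tensor product of the two
   spaces are matrices of size [k * n], indexed through [mxtens_index]. *)
Definition tens_lfun f g : 'End('M[R[i]]_(k * n)) := linfun (tens_fun f g).

Lemma tens_lfunE f g (A : 'M[R[i]]_k) (B : 'M[R[i]]_n) :
  tens_lfun f g (A *t B) = f A *t g B.
Proof.
have lfE m (h : 'End('M[R[i]]_m)) (M : 'M[R[i]]_m) i j :
    h M i j = \sum_(a < m) \sum_(b < m) M a b * h (delta_mx a b) i j.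
  rewrite [M in LHS]matrix_sum_delta linear_sum summxE; apply: eq_bigr => a _.
  rewrite linear_sum summxE; apply: eq_bigr => b _.
  by rewrite linearZ mxE.
rewrite lfunE /= /tens_fun; apply/matrixP => i j.
case: (mxtens_indexP i) => i1 i2; case: (mxtens_indexP j) => j1 j2.
rewrite tensmxE !lfE summxE mulr_suml; apply: eq_bigr => a _.
rewrite summxE mulr_suml; apply: eq_bigr => b _.
rewrite summxE mulr_sumr; apply: eq_bigr => c _.
rewrite summxE mulr_sumr; apply: eq_bigr => d _.
by rewrite mxE !tensmxE mulrACA.
Qed.

End TensorProduct.

Definition completely_positive_maps (R : realType) (n : nat) :
    set 'End('M[R[i]]_n) :=
  [set Phi | forall k : nat,
     positive_maps R (k * n) (tens_lfun (\1%VF : 'End('M[R[i]]_k)) Phi)].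
Arguments completely_positive_maps : clear implicits.

Definition mapping_cone (R : realType) (n : nat) (Q : set 'End('M[R[i]]_n)) :
    set 'End('M[R[i]]_n) :=
  [set Theta | exists (m : nat) (Phi Omega Psi : 'I_m -> 'End('M[R[i]]_n)),
     (forall j : 'I_m, [/\ Q (Omega j), completely_positive_maps R n (Phi j)
                         & completely_positive_maps R n (Psi j)])
     /\ Theta = \sum_(j < m) (Phi j \o (Omega j \o Psi j))%VF].

Definition transpose_map (R : realType) (n : nat) : 'End('M[R[i]]_n) :=
  linfun trmx.
Arguments transpose_map : clear implicits.

Lemma transpose_map_positive (R : realType) (n : nat) :
  positive_maps R n (transpose_map R n).
Proof.
move=> X posX v; rewrite lfunE /=.
have /= := posX (map_mx Num.conj v).
congr (0 <= _ :> R[i]).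
rewrite -[in RHS](trmxK (_ *m _)%R) [RHS]mxE !trmx_mul trmxK mulmxA.
congr (fun_of_matrix (_ *m _ *m _) _ _).
  by apply/matrixP => i j; rewrite !mxE conjCK.
by apply/matrixP => i j; rewrite !mxE.
Qed.

(* Main.v *)
(** Since [t \o t] is the identity, [Phi \o t \o Psi = (Phi \o (t \o Psi \o t)) \o t],
    so it suffices that complete positivity is stable under sums, composition and
    conjugation by [t]. For the last point, conjugating [id_k] by the transpose
    of order [k] gives [id_k] back, so [id_k (x) (t \o Psi \o t)] is
    [id_k (x) Psi] conjugated by [t_k (x) t], which is the full transpose on the
    tensor product and is positive. *)

Require Import Defs.
From mathcomp Require Import all_boot all_order all_algebra.
From mathcomp Require Import classical_sets reals.
From mathcomp Require Import complex mxtens.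

Set Implicit Arguments.
Unset Strict Implicit.
Unset Printing Implicit Defensive.

Import Order.TTheory GRing.Theory Num.Theory.

Local Open Scope classical_set_scope.
Local Open Scope ring_scope.

Lemma delta_mx_tens (K : comNzRingType) (m n p q : nat)
    (a : 'I_m) (b : 'I_n) (c : 'I_p) (d : 'I_q) :
  delta_mx (mxtens_index (a, c)) (mxtens_index (b, d)) =
  delta_mx a b *t delta_mx c d :> 'M[K]_(m * p, n * q).
Proof.
apply/matrixP => i j.
case: (mxtens_indexP i) => i1 i2; case: (mxtens_indexP j) => j1 j2.
rewrite tensmxE !mxE !(inj_eq (can_inj (@mxtens_indexK _ _))) -natrM mulnb.
by rewrite !xpair_eqE andbACA.
Qed.

(** Product operators span: every matrix unit of the tensor product is a product of matrix units.
    The identities below between maps on the tensor product are all checked through this. *)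
Lemma eq_lfun_tens (R : realType) (k n : nat) (f g : 'End('M[R[i]]_(k * n))) :
  (forall A B, f (A *t B) = g (A *t B)) -> f = g.
Proof.
move=> fg; apply/lfunP => X; rewrite [X]matrix_sum_delta !linear_sum /=.
apply: eq_bigr => i _; rewrite !linear_sum /=; apply: eq_bigr => j _.
rewrite !linearZ /=; congr (_ *: _).
case: (mxtens_indexP i) => i1 i2; case: (mxtens_indexP j) => j1 j2.
by rewrite delta_mx_tens fg.
Qed.

Section TensLfun.
Variables (R : realType) (k n : nat).
Implicit Types (f : 'End('M[R[i]]_k)) (g : 'End('M[R[i]]_n)).

Lemma tens_lfun1 :
  tens_lfun \1%VF \1%VF = \1%VF :> 'End('M[R[i]]_(k * n)).
Proof. by apply: eq_lfun_tens => A B; rewrite tens_lfunE !lfunE. Qed.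

Lemma tens_lfun_comp f f' g g' :
  tens_lfun (f \o f')%VF (g \o g')%VF = (tens_lfun f g \o tens_lfun f' g')%VF.
Proof.
by apply: eq_lfun_tens => A B; rewrite comp_lfunE !tens_lfunE !comp_lfunE.
Qed.

Lemma tens_lfun_sumr f (I : finType) (g_ : I -> 'End('M[R[i]]_n)) :
  tens_lfun f (\sum_i g_ i) = \sum_i tens_lfun f (g_ i).
Proof.
apply: eq_lfun_tens => A B; rewrite tens_lfunE !sum_lfunE.
(* Additivity of [*t] in its second factor, obtained entry by entry from distributivity. *)
apply/matrixP => i j; rewrite mxE !summxE mulr_sumr.
by apply: eq_bigr => l _; rewrite tens_lfunE mxE.
Qed.

Lemma tens_lfun_tr :
  tens_lfun (transpose_map R k) (transpose_map R n) = transpose_map R (k * n).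
Proof.
by apply: eq_lfun_tens => A B; rewrite tens_lfunE !lfunE /= trmx_tens.
Qed.

End TensLfun.

Lemma transpose_mapK (R : realType) (n : nat) :
  (transpose_map R n \o transpose_map R n = \1)%VF.
Proof. by apply/lfunP => X; rewrite comp_lfunE !lfunE /= trmxK. Qed.

Section Positivity.
Variables (R : realType) (n : nat).
Implicit Types f g : 'End('M[R[i]]_n).

Lemma positive_maps_comp f g :
  positive_maps R n f -> positive_maps R n g -> positive_maps R n (f \o g)%VF.
Proof. by move=> posf posg X posX; rewrite comp_lfunE; apply/posf/posg. Qed.

(** For a fixed vector the quadratic form is additive in the operator, and nonnegative numbers add
    up to a nonnegative one. *)
Lemma positive_maps_sum (I : finType) (f_ : I -> 'End('M[R[i]]_n)) :
  (forall i, positive_maps R n (f_ i)) -> positive_maps R n (\sum_i f_ i).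
Proof.
move=> posf X posX v; rewrite sum_lfunE mulmx_sumr mulmx_suml summxE.
by apply: sumr_ge0 => i _; exact: posf.
Qed.

Lemma completely_positive_maps1 : completely_positive_maps R n \1%VF.
Proof. by move=> k; rewrite tens_lfun1 => X; rewrite lfunE. Qed.

End Positivity.

Section CompletePositivity.
Variables (R : realType) (n : nat).
Implicit Types f g : 'End('M[R[i]]_n).

Lemma completely_positive_maps_comp f g :
  completely_positive_maps R n f -> completely_positive_maps R n g ->
  completely_positive_maps R n (f \o g)%VF.
Proof.
(* Splitting the identity on the ancilla as [\1 \o \1] lets the interchange law separate [f] from
   [g]. *)
move=> cpf cpg k; rewrite -[\1%VF]comp_lfun1l tens_lfun_comp.
exact: positive_maps_comp.
Qed.

Lemma completely_positive_maps_sum (I : finType)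
    (f_ : I -> 'End('M[R[i]]_n)) :
  (forall i, completely_positive_maps R n (f_ i)) ->
  completely_positive_maps R n (\sum_i f_ i).
Proof.
move=> cpf k; rewrite tens_lfun_sumr.
by apply: positive_maps_sum => i; exact: cpf.
Qed.

Lemma completely_positive_maps_conj_tr f :
  completely_positive_maps R n f ->
  completely_positive_maps R n
    (transpose_map R n \o (f \o transpose_map R n))%VF.
Proof.
move=> cpf k.
have -> : (\1 = transpose_map R k \o (\1 \o transpose_map R k))%VF.
  by rewrite comp_lfun1l transpose_mapK.
rewrite !tens_lfun_comp tens_lfun_tr.
apply: positive_maps_comp; first exact: transpose_map_positive.
exact: positive_maps_comp (cpf k) (@transpose_map_positive _ _).
Qed.

End CompletePositivity.

Theorem proposition2 (R : realType) (n : nat) :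
  mapping_cone [set transpose_map R n] =
  [set (Phi \o transpose_map R n)%VF | Phi in completely_positive_maps R n].
Proof.
apply/seteqP; split=> [Theta [m [Phi [Omega [Psi [cp ->]]]]] | _ [Phi cp <-]].
  set t := transpose_map R n.
  exists (\sum_(j < m) (Phi j \o (t \o (Psi j \o t)))%VF).
    apply: completely_positive_maps_sum => j; have [_ cpPhi cpPsi] := cp j.
    apply: completely_positive_maps_comp cpPhi _.
    exact: completely_positive_maps_conj_tr cpPsi.
  pose comp_tD (f g : 'End('M[R[i]]_n)) := comp_lfunDl f g t.
  (* Precomposition with [t] is additive, so it passes under the sum; in each term the two
     transposes now adjacent on the right cancel. *)
  rewrite (big_morph (fun f => f \o t)%VF comp_tD (comp_lfun0l _ t)).
  apply: eq_bigr => j _; have [-> _ _] := cp j.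
  by rewrite -!comp_lfunA transpose_mapK comp_lfun1r.
(* Conversely, [Phi \o t] is a one-term sum whose inner completely positive map is the identity. *)
exists 1%N, (fun=> Phi), (fun=> transpose_map R n), (fun=> \1%VF); split.
  move=> _; split; [reflexivity | exact: cp |].
  exact: completely_positive_maps1.
by rewrite big_ord1 comp_lfun1r.
Qed.
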